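(* Let $G=\mathsf{Aff}(\mathbb{R})$ with its left invariant symplectic form $\omega^+$. There are on $(G,\omega^+)$ two transversal Lagrangian foliations given respectively by $\mathcal{F}_i=\mathbb{R}e_i^+$, $i=1,2$. The Hess connection associated to this bifoliation $(\mathcal{F}_1,\mathcal{F}_2)$ is a flat affine and Lorentz connection.
   Context: $\mathsf{Aff}(\mathbb{R})$ is the group of affine transformations of the real line, with natural coordinates $(x,y)$, $x\neq0$, product $(x,y)(x',y')=(xx',xy'+y)$, and left invariant symplectic form $\omega^+=-\frac{1}{x^2}dx\wedge dy$. Its Lie algebra $\mathfrak{g}=\mathfrak{aff}(\mathbb{R})$ has basis $(e_1,e_2)$ with $[e_1,e_2]=e_2$ and left invariant fields $e_1^+=x\frac{\partial}{\partial x}$, $e_2^+=x\frac{\partial}{\partial y}$; $\omega$ denotes the value of $\omega^+$ at the identity. Let $\odot$ be the bilinear product on $\mathfrak{g}$ defined by $\omega(a\odot b,c)=-\omega(b,[a,c])$; explicitly $e_1\odot e_1=-e_1$, $e_1\odot e_2=0$, $e_2\odot e_1=-e_2$, $e_2\odot e_2=0$. Writing elements of $\mathfrak{g}=\mathbb{R}e_1\oplus\mathbb{R}e_2$ as pairs $(X_1,X_2)$, the Hess connection associated to $\mathcal{F}_1,\mathcal{F}_2$ is the left invariant connection determined by $$\nabla^H_{(X_1,X_2)}(Y_1,Y_2)=\big(X_1\odot Y_1+[X_2,Y_1]_1,\ X_2\odot Y_2+[X_1,Y_2]_2\big),$$ where $[\cdot,\cdot]_i$ is the projection of the bracket onto $\mathbb{R}e_i$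 (the $i$-th foliation). A flat affine connection is one with vanishing torsion and curvature. A Lorentz connection is one for which some left invariant Lorentzian metric on $G$ is parallel. *)

(* Defs.v *)
From Stdlib Require Import Reals Lra.
From Coquelicot Require Import Coquelicot.
Open Scope R_scope.

Notation R2 := (R * R)%type.

(** The group [Aff(R)]: the pair [(x, y)] with [x <> 0] stands for the
    transformation [t |-> x * t + y].  It is an open subset of the plane; its
    tangent spaces are all identified with [R2] through the basis
    [(d/dx, d/dy)].  Functions, vector fields and tensors are total on [R2],
    but only their restriction to [G] is ever constrained. *)

Definition G (p : R2) : Prop := fst p <> 0.
Definition aff (p : R2) (t : R) : R := fst p * t + snd p.
Definition gmul (p q : R2) : R2 := (fst p * fst q, fst p * snd q + snd p).
Definition gone : R2 := (1, 0).
Definition ginv (p : R2) : R2 := (/ fst p, - (snd p / fst p)).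

Lemma aff_gmul p q t : aff (gmul p q) t = aff p (aff q t).
Proof. unfold aff, gmul; simpl; ring. Qed.

Lemma G_gmul p q : G p -> G q -> G (gmul p q).
Proof. unfold G; simpl; intros; apply Rmult_integral_contrapositive; tauto. Qed.

Lemma gmul_assoc p q r : gmul p (gmul q r) = gmul (gmul p q) r.
Proof. unfold gmul; simpl; f_equal; ring. Qed.

Lemma gmul_1l p : gmul gone p = p.
Proof. destruct p; unfold gmul; simpl; f_equal; ring. Qed.

Lemma G_ginv p : G p -> G (ginv p).
Proof. unfold G; simpl; apply Rinv_neq_0_compat. Qed.

Lemma gmul_Vl p : G p -> gmul (ginv p) p = gone.
Proof. unfold G, gmul, gone; simpl; intros; f_equal; field; assumption. Qed.

(** Differential calculus on [G]. *)

Definition pdx (f : R2 -> R) (p : R2) : R := Derive (fun t => f (t, snd p)) (fst p).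
Definition pdy (f : R2 -> R) (p : R2) : R := Derive (fun t => f (fst p, t)) (snd p).

Fixpoint Ck (k : nat) (f : R2 -> R) : Prop :=
  (forall p, G p -> continuous f p) /\
  match k with
  | O => True
  | S k' =>
      (forall p, G p -> ex_derive (fun t => f (t, snd p)) (fst p)
                     /\ ex_derive (fun t => f (fst p, t)) (snd p)) /\
      Ck k' (pdx f) /\ Ck k' (pdy f)
  end.

Definition smooth (f : R2 -> R) : Prop := forall k, Ck k f.

Definition field := R2 -> R2.

Definition smooth_field (X : field) : Prop :=
  smooth (fun p => fst (X p)) /\ smooth (fun p => snd (X p)).

Definition deriv (f : R2 -> R) (p v : R2) : R := fst v * pdx f p + snd v * pdy f p.

Definition differential (F : R2 -> R2) (p v : R2) : R2 :=
  (deriv (fun q => fst (F q)) p v, deriv (fun q => snd (F q)) p v).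

Definition act (X : field) (f : R2 -> R) (p : R2) : R := deriv f p (X p).

(** Sign convention: [[X, Y] f = X (Y f) - Y (X f)]. *)
Definition lie (X Y : field) : field :=
  fun p => minus (differential Y p (X p)) (differential X p (Y p)).

(** Covariant 2-tensors. *)

Definition tensor := R2 -> R2 -> R2 -> R.

Definition bilinear_tensor (h : tensor) : Prop :=
  forall p, G p -> forall (a : R) (u v w : R2),
    h p (plus (scal a u) v) w = a * h p u w + h p v w /\
    h p w (plus (scal a u) v) = a * h p w u + h p w v.

Definition smooth_tensor (h : tensor) : Prop :=
  forall X Y, smooth_field X -> smooth_field Y -> smooth (fun p => h p (X p) (Y p)).

Definition left_invariant_tensor (h : tensor) : Prop :=
  forall g p v w, G g -> G p ->
    h (gmul g p) (differential (gmul g) p v) (differential (gmul g) p w) = h p v w.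

Definition nondegenerate (h : tensor) : Prop :=
  forall p, G p -> forall v, (forall w, h p v w = 0) -> v = zero.

(** [d w (X, Y, Z) = 0], by the invariant formula for the exterior derivative. *)
Definition closed_form (w : tensor) : Prop :=
  forall X Y Z p, smooth_field X -> smooth_field Y -> smooth_field Z -> G p ->
    act X (fun q => w q (Y q) (Z q)) p + act Y (fun q => w q (Z q) (X q)) p
    + act Z (fun q => w q (X q) (Y q)) p
    - w p (lie X Y p) (Z p) - w p (lie Y Z p) (X p) - w p (lie Z X p) (Y p) = 0.

Definition symplectic_form (w : tensor) : Prop :=
  bilinear_tensor w /\ smooth_tensor w /\ (forall p v, G p -> w p v v = 0) /\
  nondegenerate w /\ closed_form w.

(** Signature (1, 1). *)
Definition lorentzian_metric (h : tensor) : Prop :=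
  bilinear_tensor h /\ smooth_tensor h /\
  (forall p v w, G p -> h p v w = h p w v) /\
  (forall p, G p -> exists u v, h p u u = -1 /\ h p v v = 1 /\ h p u v = 0).

(** Foliations by curves, given by their tangent distributions, i.e. (Frobenius)
    smooth involutive distributions of rank one. *)

Definition distribution := R2 -> R2 -> Prop.

Definition smooth_line_distribution (D : distribution) : Prop :=
  forall q, G q -> exists X, smooth_field X /\
    locally q (fun p => X p <> zero /\
                        forall v, D p v <-> exists t : R, v = scal t (X p)).

Definition section (D : distribution) (X : field) : Prop := forall p, G p -> D p (X p).

Definition involutive (D : distribution) : Prop :=
  forall X Y, smooth_field X -> smooth_field Y ->
    section D X -> section D Y -> section D (lie X Y).

Definition foliation (D : distribution) : Prop :=
  smooth_line_distribution D /\ involutive D.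

Definition lagrangian (w : tensor) (D : distribution) : Prop :=
  forall p, G p -> forall v, D p v <-> (forall u, D p u -> w p v u = 0).

Definition lagrangian_foliation (w : tensor) (D : distribution) : Prop :=
  foliation D /\ lagrangian w D.

Definition transversal (D1 D2 : distribution) : Prop :=
  forall p, G p -> forall v, exists v1 v2, D1 p v1 /\ D2 p v2 /\ v = plus v1 v2.

(** Linear connections on the tangent bundle of [G], as covariant derivatives. *)

Definition connection := field -> field -> field.

Definition linear_connection (N : connection) : Prop :=
  (forall X X' Y Y', smooth_field X -> smooth_field X' ->
     smooth_field Y -> smooth_field Y' ->
     (forall p, G p -> X p = X' p) -> (forall p, G p -> Y p = Y' p) ->
     forall p, G p -> N X Y p = N X' Y' p) /\
  (forall X Y, smooth_field X -> smooth_field Y -> smooth_field (N X Y)) /\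
  (forall f X X' Y p, smooth f -> smooth_field X -> smooth_field X' ->
     smooth_field Y -> G p ->
     N (fun q => plus (scal (f q) (X q)) (X' q)) Y p
     = plus (scal (f p) (N X Y p)) (N X' Y p)) /\
  (forall X Y Y' p, smooth_field X -> smooth_field Y -> smooth_field Y' -> G p ->
     N X (fun q => plus (Y q) (Y' q)) p = plus (N X Y p) (N X Y' p)) /\
  (forall f X Y p, smooth f -> smooth_field X -> smooth_field Y -> G p ->
     N X (fun q => scal (f q) (Y q)) p
     = plus (scal (act X f p) (Y p)) (scal (f p) (N X Y p))).

Definition torsion (N : connection) (X Y : field) : field :=
  fun p => minus (minus (N X Y p) (N Y X p)) (lie X Y p).

Definition curvature (N : connection) (X Y Z : field) : field :=
  fun p => minus (minus (N X (N Y Z) p) (N Y (N X Z) p)) (N (lie X Y) Z p).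

Definition flat_affine_connection (N : connection) : Prop :=
  linear_connection N /\
  (forall X Y p, smooth_field X -> smooth_field Y -> G p -> torsion N X Y p = zero) /\
  (forall X Y Z p, smooth_field X -> smooth_field Y -> smooth_field Z -> G p ->
     curvature N X Y Z p = zero).

Definition parallel (N : connection) (h : tensor) : Prop :=
  forall X Y Z p, smooth_field X -> smooth_field Y -> smooth_field Z -> G p ->
    act X (fun q => h q (Y q) (Z q)) p = h p (N X Y p) (Z p) + h p (Y p) (N X Z p).

Definition lorentz_connection (N : connection) : Prop :=
  linear_connection N /\
  exists h, lorentzian_metric h /\ left_invariant_tensor h /\ parallel N h.

(** Left invariant fields and the Lie algebra, i.e. the tangent space at [gone]. *)

Definition lift (a : R2) : field := fun p => differential (gmul p) gone a.

Definition e1 : R2 := (1, 0).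
Definition e2 : R2 := (0, 1).
Definition bracket (a b : R2) : R2 := scal (fst a * snd b - snd a * fst b) e2.

Lemma differential_gmul g p v : differential (gmul g) p v = (fst g * fst v, fst g * snd v).
Proof.
assert (D1 : Derive (fun t => fst g * t) (fst p) = fst g).
{ apply is_derive_unique; auto_derive; [easy | ring]. }
assert (D2 : Derive (fun t => fst g * t + snd g) (snd p) = fst g).
{ apply is_derive_unique; auto_derive; [easy | ring]. }
unfold differential, deriv, pdx, pdy, gmul; simpl.
rewrite !Derive_const, D1, D2; f_equal; ring.
Qed.

Lemma lift_E a p : lift a p = (fst p * fst a, fst p * snd a).
Proof. apply differential_gmul. Qed.

Lemma lift_invariant a g p : lift a (gmul g p) = differential (gmul g) p (lift a p).
Proof. rewrite differential_gmul, !lift_E; simpl; f_equal; ring. Qed.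

Lemma lie_lift a b p : lie (lift a) (lift b) p = lift (bracket a b) p.
Proof.
assert (D : forall c t, Derive (fun s => s * c) t = c).
{ intros c t; apply is_derive_unique; auto_derive; [easy | ring]. }
assert (H : forall c v, differential (lift c) p v = (fst v * fst c, fst v * snd c)).
{ intros c v; unfold differential, deriv, pdx, pdy.
  rewrite (Derive_ext (fun t => fst (lift c (t, snd p))) (fun t => t * fst c)),
    (Derive_ext (fun t => snd (lift c (t, snd p))) (fun t => t * snd c)),
    (Derive_ext (fun t => fst (lift c (fst p, t))) (fun _ => fst p * fst c)),
    (Derive_ext (fun t => snd (lift c (fst p, t))) (fun _ => fst p * snd c))
    by (intros; rewrite lift_E; reflexivity).
  rewrite !D, !Derive_const; f_equal; ring. }
unfold lie; rewrite !H, !lift_E.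
apply injective_projections; cbv -[Rplus Rmult Ropp]; destruct a, b, p; ring.
Qed.

Definition omega_plus : tensor :=
  fun p v w => - (1 / fst p ^ 2) * (fst v * snd w - snd v * fst w).

Definition omega : R2 -> R2 -> R := omega_plus gone.

Definition F1 : distribution := fun p v => exists t : R, v = scal t (lift e1 p).
Definition F2 : distribution := fun p v => exists t : R, v = scal t (lift e2 p).

(** The left invariant connection with [N (lift a) (lift b) = lift (m a b)] for a
    bilinear product [m] on the Lie algebra: writing [X = sum_i X^i e_i^+],
    [N X Y = sum_j X(Y^j) e_j^+ + sum_(i, j) X^i Y^j (m e_i e_j)^+]. *)

Definition coef (X : field) : field := fun p => (fst (X p) / fst p, snd (X p) / fst p).

Lemma lift_coef X p : G p -> lift (coef X p) p = X p.
Proof.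
intros Gp; rewrite lift_E; unfold coef; destruct (X p); simpl.
f_equal; field; exact Gp.
Qed.

Definition left_connection (m : R2 -> R2 -> R2) : connection :=
  fun X Y p => lift (plus (differential (coef Y) p (X p)) (m (coef X p) (coef Y p))) p.

Lemma left_connection_lift m a b p :
  G p -> left_connection m (lift a) (lift b) p = lift (m a b) p.
Proof.
intros Gp.
assert (C : forall c, coef (lift c) p = c).
{ intros c; unfold coef; rewrite lift_E; destruct c; simpl; f_equal; field; exact Gp. }
assert (D : forall c, Derive (fun t => t * c / t) (fst p) = 0).
{ intros c; apply is_derive_unique; auto_derive; [exact Gp | field; exact Gp]. }
assert (H : differential (coef (lift b)) p (lift a p) = zero).
{ unfold differential, deriv, pdx, pdy.
  rewrite (Derive_ext (fun t => fst (coef (lift b) (t, snd p))) (fun t => t * fst b / t)),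
    (Derive_ext (fun t => snd (coef (lift b) (t, snd p))) (fun t => t * snd b / t)),
    (Derive_ext (fun t => fst (coef (lift b) (fst p, t))) (fun _ => fst p * fst b / fst p)),
    (Derive_ext (fun t => snd (coef (lift b) (fst p, t))) (fun _ => fst p * snd b / fst p))
    by (intros; unfold coef; rewrite lift_E; reflexivity).
  rewrite !D, !Derive_const.
  apply injective_projections; cbv -[Rplus Rmult lift]; ring. }
unfold left_connection; rewrite H, !C, plus_zero_l; reflexivity.
Qed.

Definition odot (a b : R2) : R2 := (- (fst a * fst b), - (snd a * fst b)).

Lemma odotP a b c : omega (odot a b) c = - omega b (bracket a c).
Proof.
destruct a, b, c; cbv -[Rplus Rminus Rmult Ropp Rinv]; field.
Qed.

Lemma odot_unique a b d :
  (forall c, omega d c = - omega b (bracket a c)) -> d = odot a b.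
Proof.
intros H; assert (H1 := H e1); assert (H2 := H e2); rewrite <- odotP in H1, H2.
revert H1 H2; unfold omega, omega_plus, odot, e1, e2; destruct d; simpl.
intros; f_equal; lra.
Qed.

Definition pr1 (a : R2) : R2 := scal (fst a) e1.
Definition pr2 (a : R2) : R2 := scal (snd a) e2.

Definition hess_product (X Y : R2) : R2 :=
  plus (plus (odot (pr1 X) (pr1 Y)) (pr1 (bracket (pr2 X) (pr1 Y))))
       (plus (odot (pr2 X) (pr2 Y)) (pr2 (bracket (pr1 X) (pr2 Y)))).

Definition hess_connection : connection := left_connection hess_product.

(* Main.v *)
Require Import Defs.
From Stdlib Require Import Reals.
From Coquelicot Require Import Coquelicot.

(** Since [e1, e2] = e2 has no component along e1, the definition of the Hess
    connection reduces on the frame to [N e1 e1 = - e1], [N e1 e2 = e2] and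
    [N e2 _ = 0].  The operators [N e1 = diag (-1, 1)] and [N e2 = 0] commute, the
    operator of the bracket e2 is zero as well, and [N e1 e2 - N e2 e1 = e2] is the
    bracket of e1 and e2; so the connection is flat and torsion free.  As [N e1] is
    diagonal with trace zero, it is skew for the metric in which e1, e2 are
    isotropic and [h (e1, e2) = 1]; the associated left invariant Lorentzian
    metric is therefore parallel.

    Connections act here on arbitrary smooth vector fields and not only on left
    invariant ones, so the argument is carried out in the coordinates [(x, y)].
    There the connection differs from the trivial one only by
    [N d/dx d/dx = - (2 / x) d/dx] ([hess_fst], [hess_snd]): it is the flat
    connection of the affine coordinates [1 / x] and [y].  Torsion and
    parallelism then reduce to the Leibniz rule, and curvature
    needs in addition the symmetry of second derivatives, in the form
    [deriv_commutator].  The identities about the symplectic form and the two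
    foliations are of the same kind.

    All this rests on the fact that the functions smooth on [G] form a ring,
    containing [/ x], that is stable under the partial derivatives, and that
    smoothness and derivatives on [G] depend only on restrictions to [G]. *)

(** * Coordinates in the plane *)

Lemma fst_plus (u v : R2) : fst (plus u v) = fst u + fst v.
Proof. reflexivity. Qed.

Lemma snd_plus (u v : R2) : snd (plus u v) = snd u + snd v.
Proof. reflexivity. Qed.

Lemma fst_minus (u v : R2) : fst (minus u v) = fst u - fst v.
Proof. reflexivity. Qed.

Lemma snd_minus (u v : R2) : snd (minus u v) = snd u - snd v.
Proof. reflexivity. Qed.

Lemma fst_zero : fst (zero : R2) = 0.
Proof. reflexivity. Qed.

Lemma snd_zero : snd (zero : R2) = 0.
Proof. reflexivity. Qed.

Lemma fst_scal (a : R) (u : R2) : fst (scal a u) = a * fst u.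
Proof. reflexivity. Qed.

Lemma snd_scal (a : R) (u : R2) : snd (scal a u) = a * snd u.
Proof. reflexivity. Qed.

(** * Locality on the open set [G] *)

Lemma G_open p : G p -> locally p G.
Proof.
destruct p as [x y]; intros Gp; apply (continuous_fst x y (fun t => t <> 0)), (open_neq 0 x), Gp.
Qed.

Lemma G_slice p : G p -> locally (fst p) (fun t => G (t, snd p)).
Proof. exact (open_neq 0 (fst p)). Qed.

(** Horizontal lines leave [G], but only away from the point where a derivative
    is taken; vertical lines through [G] stay inside it. *)
Lemma slice_x_ext (f g : R2 -> R) p :
  (forall q, G q -> f q = g q) -> G p ->
  locally (fst p) (fun t => f (t, snd p) = g (t, snd p)).
Proof.
intros E Gp; apply (filter_imp (fun t => G (t, snd p))); [ | now apply G_slice].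
intros t; apply E.
Qed.

Lemma slice_y_ext (f g : R2 -> R) p :
  (forall q, G q -> f q = g q) -> G p ->
  locally (snd p) (fun t => f (fst p, t) = g (fst p, t)).
Proof. intros E Gp; apply filter_forall; intros t; apply E, Gp. Qed.

Lemma pdx_ext f g p : (forall q, G q -> f q = g q) -> G p -> pdx f p = pdx g p.
Proof. intros E Gp; apply Derive_ext_loc, slice_x_ext; assumption. Qed.

Lemma pdy_ext f g p : (forall q, G q -> f q = g q) -> G p -> pdy f p = pdy g p.
Proof. intros E Gp; apply Derive_ext_loc, slice_y_ext; assumption. Qed.

Lemma deriv_ext f g p v : (forall q, G q -> f q = g q) -> G p -> deriv f p v = deriv g p v.
Proof. intros E Gp; unfold deriv; now rewrite (pdx_ext f g), (pdy_ext f g). Qed.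

(** Lets the derivative of a sum, product or inverse be replaced by the formula
    which computes it, valid on [G] only. *)
Lemma Ck_ext k f g : (forall p, G p -> f p = g p) -> Ck k f -> Ck k g.
Proof.
revert f g; induction k as [ | k IH]; intros f g E; simpl.
all: intros [Cf Df]; split.
1, 3: intros p Gp; apply (continuous_ext_loc _ f); [ | now apply Cf];
  apply (filter_imp G); [exact E | now apply G_open].
- exact I.
- destruct Df as [Df [Dx Dy]]; split; [ | split].
  + intros p Gp; destruct (Df p Gp) as [Ex Ey]; split.
    * apply (ex_derive_ext_loc (fun t => f (t, snd p))); [ | exact Ex].
      now apply slice_x_ext.
    * apply (ex_derive_ext_loc (fun t => f (fst p, t))); [ | exact Ey].
      now apply slice_y_ext.
  + apply (IH (pdx f)); [ | exact Dx]; intros; now apply pdx_ext.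
  + apply (IH (pdy f)); [ | exact Dy]; intros; now apply pdy_ext.
Qed.

Lemma smooth_ext f g : (forall p, G p -> f p = g p) -> smooth f -> smooth g.
Proof. intros E S k; exact (Ck_ext k f g E (S k)). Qed.

(** * The ring of smooth functions on [G] *)

Lemma Ck_pred k f : Ck (S k) f -> Ck k f.
Proof.
revert f; induction k as [ | k IH]; intros f [C [D [Dx Dy]]]; split; trivial.
split; [exact D | split; now apply IH].
Qed.

Lemma Ck_plus k f g : Ck k f -> Ck k g -> Ck k (fun p => f p + g p).
Proof.
revert f g; induction k as [ | k IH]; intros f g [Cf Df] [Cg Dg]; split; trivial.
1, 2: intros p Gp; exact (continuous_plus f g p (Cf p Gp) (Cg p Gp)).
destruct Df as [Df [Dxf Dyf]], Dg as [Dg [Dxg Dyg]]; split; [ | split].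
- intros p Gp; destruct (Df p Gp), (Dg p Gp); split.
  + now apply (ex_derive_plus (fun t => f (t, snd p)) (fun t => g (t, snd p))).
  + now apply (ex_derive_plus (fun t => f (fst p, t)) (fun t => g (fst p, t))).
- apply (Ck_ext k (fun p => pdx f p + pdx g p)); [ | now apply IH].
  intros p Gp; destruct (Df p Gp), (Dg p Gp); symmetry; now apply Derive_plus.
- apply (Ck_ext k (fun p => pdy f p + pdy g p)); [ | now apply IH].
  intros p Gp; destruct (Df p Gp), (Dg p Gp); symmetry; now apply Derive_plus.
Qed.

(** The Leibniz formula for the derivatives of order [k + 1] uses [f] and [g]
    themselves, whence the need for [Ck_pred]. *)
Lemma Ck_mult k f g : Ck k f -> Ck k g -> Ck k (fun p => f p * g p).
Proof.
revert f g; induction k as [ | k IH]; intros f g Kf Kg.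
all: assert (Kf' := Kf); assert (Kg' := Kg).
all: destruct Kf as [Cf Df], Kg as [Cg Dg]; split; trivial.
1, 2: intros p Gp; exact (continuous_mult f g p (Cf p Gp) (Cg p Gp)).
apply Ck_pred in Kf'; apply Ck_pred in Kg'.
destruct Df as [Df [Dxf Dyf]], Dg as [Dg [Dxg Dyg]]; split; [ | split].
- intros p Gp; destruct (Df p Gp), (Dg p Gp); split.
  + now apply (ex_derive_mult (fun t => f (t, snd p)) (fun t => g (t, snd p))).
  + now apply (ex_derive_mult (fun t => f (fst p, t)) (fun t => g (fst p, t))).
- apply (Ck_ext k (fun p => pdx f p * g p + f p * pdx g p)).
  + intros [x y] Gp; destruct (Df _ Gp), (Dg _ Gp).
    symmetry; now apply (Derive_mult (fun t => f (t, y)) (fun t => g (t, y)) x).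
  + apply Ck_plus; now apply IH.
- apply (Ck_ext k (fun p => pdy f p * g p + f p * pdy g p)).
  + intros [x y] Gp; destruct (Df _ Gp), (Dg _ Gp).
    symmetry; now apply (Derive_mult (fun t => f (x, t)) (fun t => g (x, t)) y).
  + apply Ck_plus; now apply IH.
Qed.

Lemma smooth_plus f g : smooth f -> smooth g -> smooth (fun p => f p + g p).
Proof. intros Sf Sg k; now apply Ck_plus. Qed.

Lemma smooth_mult f g : smooth f -> smooth g -> smooth (fun p => f p * g p).
Proof. intros Sf Sg k; now apply Ck_mult. Qed.

Lemma smooth_const c : smooth (fun _ => c).
Proof.
intros k; revert c; induction k as [ | k IH]; intros c; split; trivial.
1, 2: intros p Gp; apply continuous_const.
split; [ | split].
- intros p Gp; split; apply ex_derive_const.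
- apply (Ck_ext k (fun _ => 0)); [ | apply IH].
  intros p Gp; symmetry; exact (Derive_const c (fst p)).
- apply (Ck_ext k (fun _ => 0)); [ | apply IH].
  intros p Gp; symmetry; exact (Derive_const c (snd p)).
Qed.

Lemma smooth_opp f : smooth f -> smooth (fun p => - f p).
Proof.
intros Sf; apply (smooth_ext (fun p => -1 * f p)); [intros; ring | ].
exact (smooth_mult _ _ (smooth_const (-1)) Sf).
Qed.

Lemma smooth_minus f g : smooth f -> smooth g -> smooth (fun p => f p - g p).
Proof. intros Sf Sg; apply smooth_plus, smooth_opp; assumption. Qed.

Lemma smooth_fst : smooth (fun p => fst p).
Proof.
intros [ | k]; split; trivial.
1, 2: intros [x y] Gp; exact (continuous_fst x y).
split; [ | split].
- intros p Gp; split; [apply ex_derive_id | exact (ex_derive_const (fst p) (snd p))].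
- apply (Ck_ext k (fun _ => 1)); [ | apply smooth_const].
  intros p Gp; symmetry; exact (Derive_id (fst p)).
- apply (Ck_ext k (fun _ => 0)); [ | apply smooth_const].
  intros p Gp; symmetry; exact (Derive_const (fst p) (snd p)).
Qed.

Lemma pdx_inv_fst p : G p -> pdx (fun q => / fst q) p = - (/ fst p * / fst p).
Proof.
intros Gp; apply is_derive_unique; simpl; auto_derive; [exact Gp | ].
field; exact Gp.
Qed.

Lemma pdy_inv_fst p : pdy (fun q => / fst q) p = 0.
Proof. exact (Derive_const (/ fst p) (snd p)). Qed.

(** The derivative of [/ x] is [- (/ x) ^ 2], a polynomial in [/ x]: the
    induction closes up because products are already known to preserve [Ck]. *)
Lemma smooth_inv_fst : smooth (fun p => / fst p).
Proof.
intros k; induction k as [ | k IH]; split; trivial.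
1, 2: intros [x y] Gp; apply (continuous_comp fst Rinv);
  [exact (continuous_fst x y) | apply continuous_Rinv, Gp].
split; [ | split].
- intros p Gp; split; [ | exact (ex_derive_const (/ fst p) (snd p))].
  simpl; auto_derive; exact Gp.
- apply (Ck_ext k (fun p => -1 * (/ fst p * / fst p))).
  + intros p Gp; rewrite pdx_inv_fst by assumption; ring.
  + apply Ck_mult; [apply smooth_const | now apply Ck_mult].
- apply (Ck_ext k (fun _ => 0)); [ | apply smooth_const].
  intros p Gp; symmetry; apply pdy_inv_fst.
Qed.

Lemma smooth_pdx f : smooth f -> smooth (pdx f).
Proof. intros Sf k; exact (proj1 (proj2 (proj2 (Sf (S k))))). Qed.

Lemma smooth_pdy f : smooth f -> smooth (pdy f).
Proof. intros Sf k; exact (proj2 (proj2 (proj2 (Sf (S k))))). Qed.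

Lemma smooth_ex_derive f p : smooth f -> G p ->
  ex_derive (fun t => f (t, snd p)) (fst p) /\ ex_derive (fun t => f (fst p, t)) (snd p).
Proof. intros Sf; exact (proj1 (proj2 (Sf 1%nat)) p). Qed.

Lemma smooth_continuous f p : smooth f -> G p -> continuous f p.
Proof. intros Sf; exact (proj1 (Sf O) p). Qed.

Lemma pdx_pdy f p : smooth f -> G p -> pdx (pdy f) p = pdy (pdx f) p.
Proof.
intros Sf Gp; destruct p as [x y].
refine (Schwarz (fun u v => f (u, v)) x y _ _ _).
- apply locally_2d_locally.
  apply (filter_imp G); [ | now apply G_open].
  intros [u v] Guv; simpl.
  destruct (smooth_ex_derive f _ Sf Guv).
  destruct (smooth_ex_derive _ _ (smooth_pdx f Sf) Guv).
  destruct (smooth_ex_derive _ _ (smooth_pdy f Sf) Guv).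
  repeat split; assumption.
- apply continuity_2d_pt_filterlim.
  apply filterlim_ext with (f := pdx (pdy f)); [now intros [] | ].
  exact (smooth_continuous _ _ (smooth_pdx _ (smooth_pdy _ Sf)) Gp).
- apply continuity_2d_pt_filterlim.
  apply filterlim_ext with (f := pdy (pdx f)); [now intros [] | ].
  exact (smooth_continuous _ _ (smooth_pdy _ (smooth_pdx _ Sf)) Gp).
Qed.

(** * Derivations and the Lie bracket *)

Lemma deriv_plus f g p v : smooth f -> smooth g -> G p ->
  deriv (fun q => f q + g q) p v = deriv f p v + deriv g p v.
Proof.
intros Sf Sg Gp; unfold deriv.
destruct (smooth_ex_derive f p Sf Gp), (smooth_ex_derive g p Sg Gp).
assert (Ex : pdx (fun q => f q + g q) p = pdx f p + pdx g p) by now apply Derive_plus.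
assert (Ey : pdy (fun q => f q + g q) p = pdy f p + pdy g p) by now apply Derive_plus.
rewrite Ex, Ey; ring.
Qed.

Lemma deriv_mult f g p v : smooth f -> smooth g -> G p ->
  deriv (fun q => f q * g q) p v = deriv f p v * g p + f p * deriv g p v.
Proof.
intros Sf Sg Gp; unfold deriv; destruct p as [x y].
destruct (smooth_ex_derive f _ Sf Gp), (smooth_ex_derive g _ Sg Gp).
assert (Ex : pdx (fun q => f q * g q) (x, y) = pdx f (x, y) * g (x, y) + f (x, y) * pdx g (x, y))
  by now apply (Derive_mult (fun t => f (t, y)) (fun t => g (t, y)) x).
assert (Ey : pdy (fun q => f q * g q) (x, y) = pdy f (x, y) * g (x, y) + f (x, y) * pdy g (x, y))
  by now apply (Derive_mult (fun t => f (x, t)) (fun t => g (x, t)) y).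
rewrite Ex, Ey; ring.
Qed.

Lemma deriv_const c p v : deriv (fun _ => c) p v = 0.
Proof. unfold deriv, pdx, pdy; rewrite !Derive_const; ring. Qed.

Lemma deriv_opp f p v : deriv (fun q => - f q) p v = - deriv f p v.
Proof. unfold deriv, pdx, pdy; rewrite !Derive_opp; ring. Qed.

Lemma deriv_minus f g p v : smooth f -> smooth g -> G p ->
  deriv (fun q => f q - g q) p v = deriv f p v - deriv g p v.
Proof.
intros Sf Sg Gp; unfold Rminus; rewrite deriv_plus, deriv_opp; trivial.
now apply smooth_opp.
Qed.

Lemma deriv_inv_fst p v : G p ->
  deriv (fun q => / fst q) p v = - (fst v * (/ fst p * / fst p)).
Proof. intros Gp; unfold deriv; rewrite pdx_inv_fst, pdy_inv_fst; trivial; ring. Qed.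

Lemma smooth_act f X : smooth f -> smooth_field X -> smooth (fun p => deriv f p (X p)).
Proof.
intros Sf [S1 S2]; unfold deriv.
apply smooth_plus; apply smooth_mult; trivial; now (apply smooth_pdx || apply smooth_pdy).
Qed.

Ltac smoothness :=
  repeat match goal with
  | H : smooth_field _ |- _ => destruct H
  | |- smooth_field _ => split; simpl
  | |- smooth ?f => assumption
  | |- smooth (fun _ => ?c) => apply (smooth_const c)
  | |- smooth (fun q => / fst q) => apply smooth_inv_fst
  | |- smooth fst => apply smooth_fst
  | |- smooth (fun q => deriv _ q _) => apply smooth_act
  | |- smooth (pdx _) => apply smooth_pdx
  | |- smooth (pdy _) => apply smooth_pdy
  | |- smooth (fun q => _ + _) => apply smooth_plus
  | |- smooth (fun q => _ - _) => apply smooth_minus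
  | |- smooth (fun q => _ * _) => apply smooth_mult
  | |- smooth (fun q => - _) => apply smooth_opp
  end.

(** Expands the derivative of a polynomial in smooth functions and [/ x]. *)
Ltac leibniz :=
  repeat first
    [ rewrite deriv_const | rewrite deriv_opp
    | rewrite deriv_inv_fst by assumption
    | rewrite deriv_plus by (assumption || smoothness)
    | rewrite deriv_minus by (assumption || smoothness)
    | rewrite deriv_mult by (assumption || smoothness) ].

Lemma lie_fst X Y p :
  fst (lie X Y p) = deriv (fun q => fst (Y q)) p (X p) - deriv (fun q => fst (X q)) p (Y p).
Proof. reflexivity. Qed.

Lemma lie_snd X Y p :
  snd (lie X Y p) = deriv (fun q => snd (Y q)) p (X p) - deriv (fun q => snd (X q)) p (Y p).
Proof. reflexivity. Qed.

(** The first order terms are those of the bracket; the second order terms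
    cancel by the symmetry of the mixed derivatives. *)
Lemma deriv_commutator f X Y p : smooth f -> smooth_field X -> smooth_field Y -> G p ->
  deriv (fun q => deriv f q (Y q)) p (X p) - deriv (fun q => deriv f q (X q)) p (Y p)
  = deriv f p (lie X Y p).
Proof.
intros Sf SX SY Gp.
rewrite (deriv_ext _ (fun q => fst (Y q) * pdx f q + snd (Y q) * pdy f q)) by easy.
rewrite (deriv_ext (fun q => deriv f q (X q))
  (fun q => fst (X q) * pdx f q + snd (X q) * pdy f q)) by easy.
leibniz.
change (deriv f p (lie X Y p))
  with (fst (lie X Y p) * pdx f p + snd (lie X Y p) * pdy f p).
rewrite lie_fst, lie_snd.
unfold deriv; rewrite pdx_pdy by assumption; ring.
Qed.

(** * The symplectic form *)

Lemma bilinear_omega_plus : bilinear_tensor omega_plus.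
Proof.
intros p Gp a u v w; unfold omega_plus.
rewrite !fst_plus, !snd_plus, !fst_scal, !snd_scal.
split; field; exact Gp.
Qed.

Lemma smooth_omega_plus : smooth_tensor omega_plus.
Proof.
intros X Y SX SY.
apply (smooth_ext (fun p => - (/ fst p * / fst p)
  * (fst (X p) * snd (Y p) - snd (X p) * fst (Y p)))); [ | smoothness].
intros p Gp; unfold omega_plus; field; exact Gp.
Qed.

Lemma nondegenerate_omega_plus : nondegenerate omega_plus.
Proof.
intros p Gp v H.
(* The two vectors dual to the coordinates of [v] for the form at [p]. *)
assert (H1 := H (0, - fst p ^ 2)); assert (H2 := H (fst p ^ 2, 0)).
unfold omega_plus in H1, H2; simpl in H1, H2.
apply injective_projections.
- change (fst v = 0); rewrite <- H1; field; exact Gp.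
- change (snd v = 0); rewrite <- H2; field; exact Gp.
Qed.

(** The Leibniz rule for [omega_plus] in the trivial connection of the plane; the
    first term is the derivative of the density [- 1 / x ^ 2]. *)
Lemma deriv_omega_plus X Y p v : smooth_field X -> smooth_field Y -> G p ->
  deriv (fun q => omega_plus q (X q) (Y q)) p v
  = 2 * fst v / fst p ^ 3 * (fst (X p) * snd (Y p) - snd (X p) * fst (Y p))
    + omega_plus p (Defs.differential X p v) (Y p) + omega_plus p (X p) (Defs.differential Y p v).
Proof.
intros SX SY Gp.
rewrite (deriv_ext _ (fun p => - (/ fst p * / fst p)
  * (fst (X p) * snd (Y p) - snd (X p) * fst (Y p)))); [ | | exact Gp].
2: intros q Gq; unfold omega_plus; field; exact Gq.
leibniz.
unfold omega_plus, Defs.differential; simpl; field; exact Gp.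
Qed.

(** A 3-form on a surface vanishes: once derivatives are expanded, the derivatives
    of the fields cancel against the brackets, and what remains is
    alternating and trilinear in [X], [Y], [Z], hence zero in the plane. *)
Lemma closed_omega_plus : closed_form omega_plus.
Proof.
intros X Y Z p SX SY SZ Gp; unfold act.
rewrite !deriv_omega_plus by assumption.
unfold omega_plus; rewrite !lie_fst, !lie_snd; unfold Defs.differential, deriv; simpl.
field; exact Gp.
Qed.

Lemma left_invariant_omega_plus : left_invariant_tensor omega_plus.
Proof.
intros g p v w Gg Gp; rewrite !differential_gmul; unfold omega_plus; simpl.
field; split; assumption.
Qed.

Lemma symplectic_omega_plus : symplectic_form omega_plus.
Proof.
repeat split; trivial using bilinear_omega_plus, smooth_omega_plus,
  nondegenerate_omega_plus, closed_omega_plus.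
1, 2: now apply bilinear_omega_plus.
intros; unfold omega_plus; ring.
Qed.

(** * The two foliations *)

(** The leaves of [F1] are the horizontal lines and those of [F2] the vertical
    ones, so that both foliations can be studied without [lift]. *)
Lemma F1P p v : G p -> F1 p v <-> snd v = 0.
Proof.
intros Gp; unfold F1; rewrite lift_E; split.
- intros [t ->]; unfold e1; rewrite snd_scal; simpl; ring.
- intros E; exists (fst v / fst p).
  apply injective_projections; rewrite ?fst_scal, ?snd_scal; unfold e1; simpl.
  + field; exact Gp.
  + rewrite E; ring.
Qed.

Lemma F2P p v : G p -> F2 p v <-> fst v = 0.
Proof.
intros Gp; unfold F2; rewrite lift_E; split.
- intros [t ->]; unfold e2; rewrite fst_scal; simpl; ring.
- intros E; exists (snd v / fst p).
  apply injective_projections; rewrite ?fst_scal, ?snd_scal; unfold e2; simpl.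
  + rewrite E; ring.
  + field; exact Gp.
Qed.

Lemma smooth_lift a : smooth_field (lift a).
Proof.
split.
- apply (smooth_ext (fun p => fst p * fst a)); [ | smoothness].
  intros p _; exact (eq_sym (f_equal fst (lift_E a p))).
- apply (smooth_ext (fun p => fst p * snd a)); [ | smoothness].
  intros p _; exact (eq_sym (f_equal snd (lift_E a p))).
Qed.

Lemma smooth_line_lift a : a <> zero ->
  smooth_line_distribution (fun p v => exists t : R, v = scal t (lift a p)).
Proof.
intros Ha q Gq; exists (lift a); split; [apply smooth_lift | ].
apply (filter_imp G); [ | now apply G_open].
intros p Gp; split; [ | easy].
rewrite lift_E; intros E; apply Ha.
apply injective_projections; apply (Rmult_eq_reg_l (fst p)); trivial.
- rewrite (f_equal fst E : fst p * fst a = 0); symmetry; apply Rmult_0_r.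
- rewrite (f_equal snd E : fst p * snd a = 0); symmetry; apply Rmult_0_r.
Qed.

(** The second coordinates of both fields vanish on all of [G], hence so do
    their derivatives. *)
Lemma involutive_F1 : involutive F1.
Proof.
intros X Y SX SY TX TY p Gp; apply F1P; trivial; rewrite lie_snd.
rewrite (deriv_ext _ (fun _ => 0)), (deriv_ext (fun q => snd (X q)) (fun _ => 0)).
- rewrite !deriv_const; ring.
- intros q Gq; now apply (F1P q), TX.
- exact Gp.
- intros q Gq; now apply (F1P q), TY.
- exact Gp.
Qed.

Lemma involutive_F2 : involutive F2.
Proof.
intros X Y SX SY TX TY p Gp; apply F2P; trivial; rewrite lie_fst.
rewrite (deriv_ext _ (fun _ => 0)), (deriv_ext (fun q => fst (X q)) (fun _ => 0)).
- rewrite !deriv_const; ring.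
- intros q Gq; now apply (F2P q), TX.
- exact Gp.
- intros q Gq; now apply (F2P q), TY.
- exact Gp.
Qed.

Lemma lagrangian_foliation_F1 : lagrangian_foliation omega_plus F1.
Proof.
split; [split | ].
- apply smooth_line_lift; intros E; exact (R1_neq_R0 (f_equal fst E)).
- exact involutive_F1.
- intros p Gp v; rewrite F1P by assumption; split.
  + intros Ev u Eu; rewrite F1P in Eu by assumption.
    unfold omega_plus; rewrite Ev, Eu; ring.
  + intros H; assert (H1 := H (fst p ^ 2, 0)); rewrite F1P in H1 by assumption.
    specialize (H1 eq_refl); unfold omega_plus in H1; simpl in H1.
    rewrite <- H1; field; exact Gp.
Qed.

Lemma lagrangian_foliation_F2 : lagrangian_foliation omega_plus F2.
Proof.
split; [split | ].
- apply smooth_line_lift; intros E; exact (R1_neq_R0 (f_equal snd E)).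
- exact involutive_F2.
- intros p Gp v; rewrite F2P by assumption; split.
  + intros Ev u Eu; rewrite F2P in Eu by assumption.
    unfold omega_plus; rewrite Ev, Eu; ring.
  + intros H; assert (H1 := H (0, - fst p ^ 2)); rewrite F2P in H1 by assumption.
    specialize (H1 eq_refl); unfold omega_plus in H1; simpl in H1.
    rewrite <- H1; field; exact Gp.
Qed.

Lemma transversal_F1_F2 : transversal F1 F2.
Proof.
intros p Gp v; exists (fst v, 0), (0, snd v); split; [ | split].
- now apply F1P.
- now apply F2P.
- apply injective_projections; rewrite ?fst_plus, ?snd_plus; simpl; ring.
Qed.

(** * The Hess connection in coordinates *)

(** The term [- 2 X_1 Y_1 / x] has two equal sources: [N e1 e1 = - e1], and the
    derivative of the factor [1 / x] in the coefficients of [Y] along the left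
    invariant frame. *)
Lemma hess_fst X Y p : smooth_field Y -> G p ->
  fst (hess_connection X Y p)
  = deriv (fun q => fst (Y q)) p (X p) - 2 * (fst (X p) * (fst (Y p) * / fst p)).
Proof.
intros SY Gp; unfold hess_connection, left_connection; rewrite lift_E.
cbn [fst]; rewrite fst_plus.
unfold Defs.differential; cbn [fst].
change (fun q => fst (coef Y q)) with (fun q => fst (Y q) * / fst q).
leibniz.
replace (fst (hess_product (coef X p) (coef Y p)))
  with (- (fst (X p) / fst p * (fst (Y p) / fst p)))
  by (cbv -[Rplus Rmult Ropp Rinv]; ring).
field; exact Gp.
Qed.

(** Here the same derivative of [1 / x] contributes [- X_1 Y_2 / x], and it cancels
    against [N e1 e2 = e2]. *)
Lemma hess_snd X Y p : smooth_field Y -> G p ->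
  snd (hess_connection X Y p) = deriv (fun q => snd (Y q)) p (X p).
Proof.
intros SY Gp; unfold hess_connection, left_connection; rewrite lift_E.
cbn [snd]; rewrite snd_plus.
unfold Defs.differential; cbn [snd].
change (fun q => snd (coef Y q)) with (fun q => snd (Y q) * / fst q).
leibniz.
replace (snd (hess_product (coef X p) (coef Y p)))
  with (fst (X p) / fst p * (snd (Y p) / fst p))
  by (cbv -[Rplus Rmult Ropp Rinv]; ring).
field; exact Gp.
Qed.

Lemma smooth_hess X Y : smooth_field X -> smooth_field Y ->
  smooth_field (hess_connection X Y).
Proof.
intros SX SY; split.
- apply (smooth_ext (fun p => deriv (fun q => fst (Y q)) p (X p)
    - 2 * (fst (X p) * (fst (Y p) * / fst p)))).
  + intros p Gp; now rewrite hess_fst.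
  + smoothness.
- apply (smooth_ext (fun p => deriv (fun q => snd (Y q)) p (X p))).
  + intros p Gp; now rewrite hess_snd.
  + smoothness.
Qed.

Lemma smooth_field_plus X Y : smooth_field X -> smooth_field Y ->
  smooth_field (fun q => plus (X q) (Y q)).
Proof.
intros [X1 X2] [Y1 Y2]; split.
- exact (smooth_plus _ _ X1 Y1).
- exact (smooth_plus _ _ X2 Y2).
Qed.

Lemma smooth_field_scal f X : smooth f -> smooth_field X ->
  smooth_field (fun q => scal (f q) (X q)).
Proof.
intros Sf [X1 X2]; split.
- exact (smooth_mult _ _ Sf X1).
- exact (smooth_mult _ _ Sf X2).
Qed.

Lemma linear_hess : linear_connection hess_connection.
Proof.
split; [ | split; [ | split; [ | split]]].
- intros X X' Y Y' SX SX' SY SY' EX EY p Gp; apply injective_projections.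
  + rewrite !hess_fst, EX, EY by assumption.
    rewrite (deriv_ext _ (fun q => fst (Y' q))); trivial.
    intros q Gq; now rewrite EY.
  + rewrite !hess_snd, EX by assumption.
    apply deriv_ext; trivial.
    intros q Gq; now rewrite EY.
- exact smooth_hess.
- intros f X X' Y p Sf SX SX' SY Gp; apply injective_projections;
    rewrite ?fst_plus, ?snd_plus, ?fst_scal, ?snd_scal.
  + rewrite !hess_fst by assumption; unfold deriv.
    rewrite !fst_plus, !snd_plus, !fst_scal, !snd_scal; ring.
  + rewrite !hess_snd by assumption; unfold deriv.
    rewrite !fst_plus, !snd_plus, !fst_scal, !snd_scal; ring.
- intros X Y Y' p SX SY SY' Gp.
  assert (S := smooth_field_plus _ _ SY SY').
  apply injective_projections; rewrite ?fst_plus, ?snd_plus.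
  + rewrite !hess_fst, fst_plus by assumption.
    change (fun q => fst (plus (Y q) (Y' q))) with (fun q => fst (Y q) + fst (Y' q)).
    leibniz; ring.
  + rewrite !hess_snd by assumption.
    change (fun q => snd (plus (Y q) (Y' q))) with (fun q => snd (Y q) + snd (Y' q)).
    leibniz; ring.
- intros f X Y p Sf SX SY Gp.
  assert (S := smooth_field_scal _ _ Sf SY).
  apply injective_projections; rewrite ?fst_plus, ?snd_plus, ?fst_scal, ?snd_scal.
  + rewrite !hess_fst, fst_scal by assumption.
    change (fun q => fst (scal (f q) (Y q))) with (fun q => f q * fst (Y q)).
    unfold act; leibniz; ring.
  + rewrite !hess_snd by assumption.
    change (fun q => snd (scal (f q) (Y q))) with (fun q => f q * snd (Y q)).
    unfold act; leibniz; ring.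
Qed.

Lemma torsion_hess X Y p : smooth_field X -> smooth_field Y -> G p ->
  torsion hess_connection X Y p = zero.
Proof.
intros SX SY Gp; unfold torsion; apply injective_projections.
- rewrite !fst_minus, !hess_fst, lie_fst, fst_zero by assumption; ring.
- rewrite !snd_minus, !hess_snd, lie_snd, snd_zero by assumption; ring.
Qed.

Lemma curvature_hess X Y Z p : smooth_field X -> smooth_field Y -> smooth_field Z -> G p ->
  curvature hess_connection X Y Z p = zero.
Proof.
intros SX SY SZ Gp; unfold curvature.
(* Only the first two terms below are not symmetric in [U] and [V]; they are
   matched by those of [N [U, V] Z]. *)
assert (SYZ := smooth_hess Y Z SY SZ); assert (SXZ := smooth_hess X Z SX SZ).
assert (E : forall U V, smooth_field U -> smooth_field V ->
  fst (hess_connection U (hess_connection V Z) p)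
  = deriv (fun q => deriv (fun q => fst (Z q)) q (V q)) p (U p)
    - 2 * deriv (fun q => fst (V q)) p (U p) * fst (Z p) / fst p
    - 2 * fst (V p) / fst p * deriv (fun q => fst (Z q)) p (U p)
    - 2 * fst (U p) / fst p * deriv (fun q => fst (Z q)) p (V p)
    + 6 * fst (U p) * fst (V p) * fst (Z p) / fst p ^ 2).
{ intros U V SU SV; rewrite hess_fst, hess_fst; trivial; [ | now apply smooth_hess].
  rewrite (deriv_ext _ (fun q => deriv (fun q => fst (Z q)) q (V q)
    - 2 * (fst (V q) * (fst (Z q) * / fst q)))); trivial.
  2: intros q Gq; now apply hess_fst.
  leibniz; field; exact Gp. }
apply injective_projections.
- rewrite !fst_minus, !E, hess_fst, <- deriv_commutator, lie_fst, fst_zero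
    by (assumption || apply SZ).
  field; exact Gp.
- rewrite !snd_minus, !hess_snd, <- deriv_commutator, snd_zero
    by (assumption || apply SZ || now apply smooth_hess).
  rewrite (deriv_ext (fun q => snd (hess_connection Y Z q))
    (fun q => deriv (fun q => snd (Z q)) q (Y q))); trivial.
  2: intros q Gq; now apply hess_snd.
  rewrite (deriv_ext (fun q => snd (hess_connection X Z q))
    (fun q => deriv (fun q => snd (Z q)) q (X q))); trivial.
  2: intros q Gq; now apply hess_snd.
  ring.
Qed.

(** * The invariant Lorentzian metric *)

(** The metric [(dx dy + dy dx) / x ^ 2], equal to [1] on [(e1, e2)] and to [0] on
    [(e1, e1)] and [(e2, e2)]. *)
Definition hess_metric : tensor :=
  fun p v w => (fst v * snd w + snd v * fst w) / fst p ^ 2.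

Lemma hess_metric_field X Y q : G q ->
  hess_metric q (X q) (Y q)
  = (/ fst q * / fst q) * (fst (X q) * snd (Y q) + snd (X q) * fst (Y q)).
Proof. intros Gq; unfold hess_metric; field; exact Gq. Qed.

Lemma lorentzian_hess_metric : lorentzian_metric hess_metric.
Proof.
split; [ | split; [ | split]].
- intros p Gp a u v w; unfold hess_metric.
  rewrite !fst_plus, !snd_plus, !fst_scal, !snd_scal.
  split; field; exact Gp.
- intros X Y SX SY.
  apply (smooth_ext (fun q => (/ fst q * / fst q)
    * (fst (X q) * snd (Y q) + snd (X q) * fst (Y q)))); [ | smoothness].
  intros q Gq; symmetry; now apply (hess_metric_field X Y).
- intros p v w Gp; unfold hess_metric; field; exact Gp.
- (* The orthonormal frame [e1 - e2 / 2], [e1 + e2 / 2]. *)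
  intros p Gp; exists (fst p, - (fst p / 2)), (fst p, fst p / 2).
  unfold hess_metric; simpl; repeat split; field; exact Gp.
Qed.

Lemma left_invariant_hess_metric : left_invariant_tensor hess_metric.
Proof.
intros g p v w Gg Gp; rewrite !differential_gmul; unfold hess_metric; simpl.
field; split; assumption.
Qed.

(** The derivative of [1 / x ^ 2] is what the coefficient [- 2 / x] of the
    connection compensates. *)
Lemma parallel_hess_metric : parallel hess_connection hess_metric.
Proof.
intros X Y Z p SX SY SZ Gp; unfold act.
rewrite (deriv_ext _ _ p (X p) (hess_metric_field Y Z) Gp); leibniz.
unfold hess_metric; rewrite !hess_fst, !hess_snd by assumption.
field; exact Gp.
Qed.

Theorem proposition4p3 :
  (symplectic_form omega_plus /\ left_invariant_tensor omega_plus) /\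
  (lagrangian_foliation omega_plus F1 /\ lagrangian_foliation omega_plus F2 /\
   transversal F1 F2) /\
  flat_affine_connection hess_connection /\ lorentz_connection hess_connection.
Proof.
split; [ | split; [ | split]].
- exact (conj symplectic_omega_plus left_invariant_omega_plus).
- exact (conj lagrangian_foliation_F1 (conj lagrangian_foliation_F2 transversal_F1_F2)).
- exact (conj linear_hess (conj torsion_hess curvature_hess)).
- split; [exact linear_hess | exists hess_metric].
  exact (conj lorentzian_hess_metric (conj left_invariant_hess_metric parallel_hess_metric)).
Qed.
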